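(* Let $q=2^e$ with $e\ge 3$ odd, let $r\ge 2$, and let $\sigma=2^{\frac{e+1}{2}}$. For $i=1,2$ let $\varepsilon_i\in\mathbb{F}_{q^2}\setminus\mathbb{F}_q$ be such that $\varepsilon_i^2+\varepsilon_i=\delta_i$ with $\delta_i\in\mathbb{F}_q\setminus\{1\}$ and $\mathrm{Tr}_{q/2}(\delta_i)=1$. Put $\alpha=\varepsilon_2-\varepsilon_1$, $B=\left(\frac{\alpha}{\delta_1}\right)^{\sigma/2}$ and $\rho=\left(\frac{\delta_1}{\delta_2}\right)^{\sigma/2+1}$. Then the projectivity $\xi$ of $\mathrm{PG}(r,q^2)$ represented by the $(r+1)\times(r+1)$ matrix $$\begin{pmatrix} 1 & B\rho\frac{\varepsilon_2}{\varepsilon_1} & B\rho\frac{\varepsilon_2}{\varepsilon_1} & \cdots & B\rho\frac{\varepsilon_2}{\varepsilon_1} & (r-1)\rho^2B^{\sigma+2}\frac{\varepsilon_2^{q+2}}{\varepsilon_1^{q+1}}\\ 0 & \frac{\rho\varepsilon_2}{\varepsilon_1} & 0 & \cdots & 0 & B\rho^2\frac{\varepsilon_2^{q+1}}{\varepsilon_1^{q+1}}\\ 0 & 0 & \frac{\rho\varepsilon_2}{\varepsilon_1} & \cdots & 0 & B\rho^2\frac{\varepsilon_2^{q+1}}{\varepsilon_1^{q+1}}\\ \vdots & \vdots & \vdots & \ddots & \vdots & \vdots\\ 0 & 0 & 0 & \cdots & \frac{\rho\varepsilon_2}{\varepsilon_1} & B\rho^2\frac{\varepsilon_2^{q+1}}{\varepsilon_1^{q+1}}\\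 0 & 0 & 0 & \cdots & 0 & \frac{\rho^2\varepsilon_2^{q+1}}{\varepsilon_1^{q+1}} \end{pmatrix}$$ (acting on row vectors of homogeneous coordinates by right multiplication) maps $\mathcal{H}^r_{\varepsilon_1}$ onto $\mathcal{H}^r_{\varepsilon_2}$. In particular, $\mathcal{H}^r_{\varepsilon_1}$ and $\mathcal{H}^r_{\varepsilon_2}$ are projectively equivalent.
   Context: Points of $\mathrm{PG}(r,q^2)$ have homogeneous coordinates $(X_0,X_1,\ldots,X_r)$; $\Pi_\infty$ is the hyperplane $X_0=0$; affine points have $X_0\neq 0$ and affine coordinates $x_i=X_i/X_0$. The map $\sigma:x\mapsto x^{2^{(e+1)/2}}$ is an automorphism of $\mathbb{F}_q$; in exponents, $\sigma$ denotes the integer $2^{(e+1)/2}$ (so $\sigma/2=2^{(e-1)/2}$). $\mathrm{Tr}_{q/2}$ is the absolute trace of $\mathbb{F}_q$ over $\mathbb{F}_2$. For $\varepsilon\in\mathbb{F}_{q^2}\setminus\mathbb{F}_q$ with $\varepsilon^2+\varepsilon+\delta=0$, $\delta\in\mathbb{F}_q\setminus\{1\}$, $\mathrm{Tr}_{q/2}(\delta)=1$, put $$\Gamma_\varepsilon(x)=[x+(x^q+x)\varepsilon]^{\sigma+2}+(x^q+x)^\sigma+(x^{2q}+x^2)\varepsilon+x^{q+1}+x^2 .$$ The BT quasi-Hermitian variety $\mathcal{H}^r_\varepsilon\subset\mathrm{PG}(r,q^2)$ is the set consisting of the affine points $(x_1,\ldots,x_r)\in\mathbb{F}_{q^2}^r$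 with $x_r^q+x_r=\Gamma_\varepsilon(x_1)+\cdots+\Gamma_\varepsilon(x_{r-1})$, together with the points $(0,X_1,\ldots,X_r)$ of $\Pi_\infty$ with $X_1^{q+1}+\cdots+X_{r-1}^{q+1}=0$. *)

(* Defs.v *)
From HB Require Import structures.
From mathcomp Require Import all_boot all_algebra.

Set Implicit Arguments.
Unset Strict Implicit.
Unset Printing Implicit Defensive.

Import GRing.Theory.
Local Open Scope ring_scope.

(* Points are the one-dimensional subspaces of the space of row vectors
   (X_0, ..., X_r); X is a vector of homogeneous coordinates of P when
   P is the line spanned by X. *)
Record PG (r : nat) (K : finFieldType) := PGPoint {
  PG_space : {vspace 'rV[K]_r.+1};
  _ : \dim PG_space == 1%N
}.

HB.instance Definition _ (r : nat) (K : finFieldType) :=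
  [isSub for @PG_space r K].

Definition hom_coords (r : nat) (K : finFieldType) (P : PG r K)
    (X : 'rV[K]_r.+1) : bool :=
  PG_space P == <[X]>%VS.

Lemma PG_vectorsK (r : nat) (K : finFieldType) :
  pcancel (fun P : PG r K => [set X | X \in PG_space P])
          (fun S => insub <<enum S>>%VS).
Proof.
move=> P; suff -> : <<enum [set X | X \in PG_space P]>>%VS = PG_space P.
  exact: valK.
apply/eqP; rewrite eqEsubv; apply/andP; split.
  by apply/span_subvP => X; rewrite mem_enum inE.
by apply/subvP => X PX; apply: memv_span; rewrite mem_enum inE.
Qed.

HB.instance Definition _ (r : nat) (K : finFieldType) :=
  Finite.copy (PG r K) (pcan_type (@PG_vectorsK r K)).

Lemma proj_dim (r : nat) (K : finFieldType) (M : 'M[K]_r.+1)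
    (uM : M \in unitmx) (P : PG r K) :
  \dim (linfun (mulmxr M : 'rV[K]_r.+1 -> 'rV[K]_r.+1) @: PG_space P)%VS == 1%N.
Proof.
rewrite limg_dim_eq; first by case: P.
suff /eqP-> : lker (linfun (mulmxr M : 'rV[K]_r.+1 -> 'rV[K]_r.+1)) == 0%VS.
  by rewrite capv0.
apply/lker0P => X Y; rewrite !lfunE /=.
exact: (can_inj (mulmxK uM)).
Qed.

Definition projectivity (r : nat) (K : finFieldType) (M : 'M[K]_r.+1)
    (uM : M \in unitmx) (P : PG r K) : PG r K :=
  PGPoint (proj_dim uM P).

Definition projectively_equivalent (r : nat) (K : finFieldType)
    (A B : {set PG r K}) : Prop :=
  exists (M : 'M[K]_r.+1) (uM : M \in unitmx), projectivity uM @: A = B.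

(* Below K is the field with q ^ 2 elements, q = 2 ^ e, and F_q is its
   unique subfield with q elements. *)
Definition in_Fq (e : nat) (K : finFieldType) (x : K) : bool :=
  x ^+ (2 ^ e)%N == x.

Definition sigma (e : nat) : nat := (2 ^ (e.+1 %/ 2))%N.

(* The trace from F_q to F_2, as the sum of the conjugates of x under the
   Galois group of F_q over F_2; it is only meaningful for x in F_q. *)
Definition abs_trace (e : nat) (K : finFieldType) (x : K) : K :=
  \sum_(i < e) x ^+ (2 ^ i)%N.

Definition Gamma (e : nat) (K : finFieldType) (eps x : K) : K :=
  let q := (2 ^ e)%N in
  (x + (x ^+ q + x) * eps) ^+ (sigma e + 2)%N + (x ^+ q + x) ^+ sigma e
  + (x ^+ (2 * q)%N + x ^+ 2) * eps + x ^+ q.+1 + x ^+ 2.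

(* The equations of the variety on homogeneous coordinates: the indices
   0 < i < r are those of the coordinates X_1, ..., X_(r-1), and ord_max is
   the index of X_r. *)
Definition BT_affine (r e : nat) (K : finFieldType) (eps : K)
    (X : 'rV[K]_r.+1) : bool :=
  let q := (2 ^ e)%N in
  let x := fun i => X 0 i / X 0 ord0 in
  (X 0 ord0 != 0) &&
  (x ord_max ^+ q + x ord_max ==
     \sum_(i < r.+1 | (0 < i < r)%N) Gamma e eps (x i)).

Definition BT_infinity (r e : nat) (K : finFieldType)
    (X : 'rV[K]_r.+1) : bool :=
  (X 0 ord0 == 0) && (\sum_(i < r.+1 | (0 < i < r)%N) X 0 i ^+ (2 ^ e)%N.+1 == 0).

Definition BT_quasi_Hermitian (r e : nat) (K : finFieldType) (eps : K) :
    {set PG r K} :=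
  [set P | [exists X, hom_coords P X &&
                      (BT_affine e eps X || BT_infinity e X)]].

Definition xi_matrix (r e : nat) (K : finFieldType)
    (eps1 eps2 delta1 delta2 : K) : 'M[K]_r.+1 :=
  let q := (2 ^ e)%N in
  let alpha := eps2 - eps1 in
  let B := (alpha / delta1) ^+ (sigma e %/ 2) in
  let rho := (delta1 / delta2) ^+ (sigma e %/ 2 + 1)%N in
  \matrix_(i < r.+1, j < r.+1)
    if i == ord0 then
      if j == ord0 then 1
      else if j == ord_max then
        (r - 1)%N%:R * rho ^+ 2 * B ^+ (sigma e + 2)%N
          * (eps2 ^+ (q + 2)%N / eps1 ^+ q.+1)
      else B * rho * (eps2 / eps1)
    else if i == ord_max then
      if j == ord_max then rho ^+ 2 * eps2 ^+ q.+1 / eps1 ^+ q.+1 else 0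
    else
      if j == ord_max then B * rho ^+ 2 * (eps2 ^+ q.+1 / eps1 ^+ q.+1)
      else if j == i then rho * eps2 / eps1
      else 0.

(* Main.v *)
Require Import Defs.
From mathcomp Require Import all_boot all_algebra.
From mathcomp Require Import finfield ring.

Set Implicit Arguments.
Unset Strict Implicit.
Unset Printing Implicit Defensive.

Import GRing.Theory.
Local Open Scope ring_scope.

(** Over F_q, (1, eps) is a basis of the field with q^2 elements, and for
    x = a + b * eps with a and b in F_q one finds
      Gamma_eps (x) = a^(sigma+2) + b^sigma + a * b
    (Gamma_coords), so the choice of eps only matters through the basis. The
    middle columns of xi act on each affine coordinate by
      x |-> c * (x + B),   c = rho * eps2 / eps1,
    and eps2 / eps1 has coordinates delta2 / delta1 and
    (eps2 - eps1) / delta1 = B^sigma in the basis (1, eps2) (eps_ratio).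
    Passing from the basis (1, eps1) to (1, eps2), the map is therefore the
    translation a |-> a + B, followed by a shear by B^sigma and a scaling.
    Because sigma squares to the Frobenius map x |-> x^2 on F_q,
      Gamma_eps2 (c * (x + B)) =
        lam * (Gamma_eps1 (x) + B^(sigma+2) + B * (x^q + x)),
    with lam = rho^2 * delta2 / delta1 in F_q (Gamma_scale_shift); the
    exponent of rho is chosen so that all the monomials get the same factor.

    The two extra terms are relative traces v^q + v, namely those of
    B^(sigma+2) * eps2 and of B * x. The last column of xi adds exactly these to
    the last coordinate, once for each of the r - 1 middle coordinates, so
    that a vector satisfies the affine equation for eps1 if and only if its
    image satisfies the one for eps2 (BT_affine_xi). At infinity the
    Hermitian equation is multiplied by c^(q+1) (BT_infinity_xi). Since xi is
    invertible, the equivalence of the equations on vectors gives the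
    equality of the point sets (projectivity_onto). *)

(** * The exponent sigma *)

Lemma sigmaE e : odd e -> sigma e = (2 ^ (e./2).+1)%N.
Proof.
by move=> e_odd; rewrite /sigma divn2 -[in e.+1](odd_double_half e) e_odd /=
  doubleK.
Qed.

Lemma half_sigmaE e : odd e -> (sigma e %/ 2)%N = (2 ^ e./2)%N.
Proof. by move=> e_odd; rewrite sigmaE // expnS mulKn. Qed.

(** * Rings of characteristic two *)

Section CharTwo.

Variables (R : comNzRingType) (charR : 2 \in [pchar R]).

(** The tactics ring and field do not know that 2 = 0, so identities in
    characteristic 2 are proved by exhibiting half of the difference. *)
Lemma eq_mod2 (t x y : R) : x = y + t + t -> x = y.
Proof. by move=> ->; rewrite -addrA addrr_pchar2 // addr0. Qed.

Lemma exprD_pow2 n (x y : R) :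
  (x + y) ^+ (2 ^ n)%N = x ^+ (2 ^ n)%N + y ^+ (2 ^ n)%N.
Proof.
by rewrite exprDn_pchar // (eq_pnat _ (pcharf_eq charR)) pnatX pnat_id.
Qed.

Lemma natr_pow2 n m : (m%:R : R) ^+ (2 ^ n)%N = m%:R.
Proof.
elim: m => [|m IHm]; first by rewrite expr0n expn_eq0.
by rewrite -addn1 natrD exprD_pow2 IHm expr1n.
Qed.

End CharTwo.

(** * The function Gamma on the field with q^2 elements *)

Section Arithmetic.

Variables (e : nat) (K : finFieldType).
Hypotheses (e_odd : odd e) (cardK : #|K| = ((2 ^ e) ^ 2)%N).

Let q := (2 ^ e)%N.

Lemma pchar2 : 2 \in [pchar K].
Proof. by move: cardK; rewrite -expnM => /card_finPcharP; exact. Qed.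

Let charK := pchar2.

Lemma conj_involutive (x : K) : (x ^+ q) ^+ q = x.
Proof. by rewrite -exprM mulnn -cardK expf_card. Qed.

Lemma exprD_sigma (x y : K) :
  (x + y) ^+ sigma e = x ^+ sigma e + y ^+ sigma e.
Proof. by rewrite sigmaE // (exprD_pow2 charK). Qed.

(** The exponent sigma / 2 times sigma is q, so on F_q the automorphism
    sigma is inverse to the power sigma / 2: this is why B is a
    (sigma / 2)-th power. *)
Lemma half_sigmaK (x : K) :
  x ^+ q = x -> (x ^+ (sigma e %/ 2)%N) ^+ sigma e = x.
Proof.
move=> xq; rewrite -exprM half_sigmaE // sigmaE // -expnD -[RHS]xq /q.
by rewrite addnS addnn -[in RHS](odd_double_half e) e_odd.
Qed.

Lemma sigma_sigma (x : K) : x ^+ q = x -> (x ^+ sigma e) ^+ sigma e = x ^+ 2.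
Proof.
move=> xq; have hs : (sigma e = (sigma e %/ 2) * 2)%N.
  by rewrite half_sigmaE // sigmaE // expnSr.
by rewrite [in x ^+ _]hs exprM exprAC half_sigmaK.
Qed.

(** The conjugate of eps is a root of T^2 + T + delta other than eps, and
    the roots of this polynomial are eps and eps + 1. *)
Lemma eps_conj (eps delta : K) :
  ~~ in_Fq e eps -> in_Fq e delta -> eps ^+ 2 + eps = delta ->
  eps ^+ q = eps + 1.
Proof.
rewrite /in_Fq -/q => epsN /eqP deltaq eps_eq.
have epsq_eq : (eps ^+ q) ^+ 2 + eps ^+ q = delta.
  by rewrite exprAC -(exprD_pow2 charK) eps_eq.
have /eqP : (eps ^+ q - eps) * (eps ^+ q + eps + 1) = 0.
  by transitivity ((eps ^+ q) ^+ 2 + eps ^+ q - (eps ^+ 2 + eps));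
    [ring | rewrite epsq_eq eps_eq subrr].
rewrite mulf_eq0 subr_eq0 (negbTE epsN) /=.
by rewrite -addrA addr_eq0 (oppr_pchar2 charK) => /eqP.
Qed.

Lemma eps_norm (eps delta : K) :
  eps ^+ q = eps + 1 -> eps ^+ 2 + eps = delta -> eps ^+ q.+1 = delta.
Proof. by move=> epsq <-; rewrite exprS epsq; ring. Qed.

Lemma eps_neq0 (eps delta : K) :
  eps ^+ 2 + eps = delta -> delta != 0 -> eps != 0.
Proof. by move=> <-; apply: contraNneq => ->; rewrite expr0n addr0. Qed.

(** For x = a + b * eps the conjugate of x is x + b, so x^q + x = b and
    x + (x^q + x) * eps = a: in these coordinates Gamma is the F_q-valued
    form that defines a Buekenhout-Tits unital. *)
Lemma Gamma_coords (eps a b : K) :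
  eps ^+ q = eps + 1 -> a ^+ q = a -> b ^+ q = b ->
  Gamma e eps (a + b * eps) = a ^+ (sigma e + 2)%N + b ^+ sigma e + a * b.
Proof.
move=> epsq aq bq; rewrite /Gamma -/q.
have xq : (a + b * eps) ^+ q = a + b * eps + b.
  by rewrite (exprD_pow2 charK) exprMn -/q epsq aq bq; ring.
have tx : a + b * eps + b + (a + b * eps) = b.
  by apply: (eq_mod2 charK (t := a + b * eps)); ring.
rewrite (exprS _ q) (mulnC 2) exprM xq tx.
have -> : a + b * eps + b * eps = a.
  by apply: (eq_mod2 charK (t := b * eps)); ring.
set x := a + b * eps.
apply: (eq_mod2 charK
  (t := (x ^+ 2 + x * b + b ^+ 2) * eps + x ^+ 2)).
by rewrite /x; ring.
Qed.

Lemma relative_trace_Fq (x : K) : (x ^+ q + x) ^+ q = x ^+ q + x.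
Proof. by rewrite (exprD_pow2 charK) -/q conj_involutive addrC. Qed.

Lemma coord_Fq (eps x : K) : eps ^+ q = eps + 1 ->
  (x + (x ^+ q + x) * eps) ^+ q = x + (x ^+ q + x) * eps.
Proof.
move=> epsq; rewrite (exprD_pow2 charK) exprMn -/q relative_trace_Fq epsq.
by apply: (eq_mod2 charK (t := x ^+ q)); ring.
Qed.

(** The coordinates of eps2 / eps1 in the basis (1, eps2) over F_q: since the
    conjugate of eps1 is eps1 + 1, the inverse of eps1 is
    (eps1 + 1) / delta1, and eps1 is eps2 up to an element of F_q. *)
Lemma eps_ratio (eps1 eps2 delta1 delta2 : K) :
  eps1 ^+ 2 + eps1 = delta1 -> eps2 ^+ 2 + eps2 = delta2 -> delta1 != 0 ->
  eps2 / eps1 = delta2 / delta1 + (eps2 - eps1) / delta1 * eps2.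
Proof.
move=> eps1_eq eps2_eq d1N0; have eps1N0 := eps_neq0 eps1_eq d1N0.
apply: (canLR (mulfK eps1N0)); rewrite -eps2_eq.
apply: (eq_mod2 charK (t := eps2 * eps1 * (eps1 - eps2) / delta1)).
by rewrite -eps1_eq; field; rewrite eps1_eq.
Qed.

(** In the coordinates (a, b) of x over (1, eps1), the map multiplies a + B
    by rho * delta2 / delta1 and sends b to a multiple of
    b + B ^ sigma * (a + B). The form a^(sigma+2) + b^sigma + a*b is
    preserved by this translation and shear up to the two correction terms;
    the cancellation rests on B ^ (sigma * sigma) = B ^ 2. The last two
    hypotheses on rho make the three monomials scale alike. *)
Lemma Gamma_scale_shift (eps1 eps2 delta1 delta2 B rho x : K) :
  eps1 ^+ q = eps1 + 1 -> eps2 ^+ q = eps2 + 1 ->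
  eps1 ^+ 2 + eps1 = delta1 -> eps2 ^+ 2 + eps2 = delta2 ->
  delta1 != 0 -> delta1 ^+ q = delta1 -> delta2 ^+ q = delta2 ->
  B ^+ q = B -> B ^+ sigma e = (eps2 - eps1) / delta1 ->
  rho ^+ q = rho -> rho ^+ sigma e = rho ^+ 2 * (delta2 / delta1) ->
  rho ^+ 2 * (delta2 / delta1) ^+ (sigma e + 2)%N = 1 ->
  Gamma e eps2 (rho * (eps2 / eps1) * (x + B)) =
  rho ^+ 2 * (delta2 / delta1) *
    (Gamma e eps1 x + B ^+ (sigma e + 2)%N + B * (x ^+ q + x)).
Proof.
move=> eps1q eps2q eps1_eq eps2_eq d1N0 d1q d2q Bq Bs rhoq rhos rho2.
have eps1N0 := eps_neq0 eps1_eq d1N0.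
set beta := (eps2 - eps1) / delta1 in Bs.
set k := delta2 / delta1 in rhos rho2 *.
have kq : k ^+ q = k by rewrite /k expr_div_n d2q d1q.
have betaq : beta ^+ q = beta by rewrite -Bs exprAC Bq.
have ratioE : eps2 / eps1 = k + beta * eps2 by exact: eps_ratio.
set b := x ^+ q + x; set a := x + b * eps1.
have bq : b ^+ q = b by exact: relative_trace_Fq.
have aq : a ^+ q = a by exact: coord_Fq.
have xE : x = a + b * eps1.
  by apply: (eq_mod2 charK (t := - (b * eps1))); rewrite /a; ring.
have -> : Gamma e eps1 x = a ^+ (sigma e + 2)%N + b ^+ sigma e + a * b.
  by rewrite -(Gamma_coords eps1q aq bq) -xE.
have -> : rho * (eps2 / eps1) * (x + B) =
    rho * (a + B) * k + rho * ((a + B) * beta + b) * eps2.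
  transitivity (rho * (eps2 / eps1) * (a + B) - rho * b * eps2).
    by rewrite /a; field.
  rewrite ratioE; apply: (eq_mod2 charK (t := - (rho * b * eps2))); ring.
clearbody k beta a b.
have aBq : (a + B) ^+ q = a + B by rewrite (exprD_pow2 charK) -/q aq Bq.
rewrite Gamma_coords //; last 2 first.
- by rewrite !exprMn aBq rhoq kq.
- by rewrite exprMn (exprD_pow2 charK) exprMn -/q aBq rhoq bq betaq.
move: rho2; rewrite !exprD !exprMn !exprD_sigma exprMn !exprD_sigma rhos.
rewrite -Bs sigma_sigma // => rho2.
set P := a ^+ sigma e in rho2 *; set S := B ^+ sigma e in rho2 *.
apply: (eq_mod2 charK (t := rho ^+ 2 * k *
  (P * a * B + P * B ^+ 2 + S * a ^+ 2 + 2%:R * S * a * B + S * B ^+ 2))).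
by ring: rho2.
Qed.

(** For u = delta1 / delta2 these are the hypotheses on rho in
    Gamma_scale_shift: rho^2 = u^(sigma+2) because 2 * (sigma / 2) = sigma,
    and rho^sigma = u^(sigma+1) by half_sigmaK. *)
Lemma scale_powers (u : K) : u != 0 -> u ^+ q = u ->
  let rho := u ^+ (sigma e %/ 2 + 1)%N in
  [/\ rho ^+ q = rho, rho ^+ sigma e = rho ^+ 2 * u^-1
    & rho ^+ 2 * u^-1 ^+ (sigma e + 2)%N = 1].
Proof.
move=> uN0 uq rho.
have rho2E : rho ^+ 2 = u ^+ (sigma e + 2)%N.
  by rewrite /rho -exprM mulnDl half_sigmaE // sigmaE // -expnSr.
split; first by rewrite /rho exprAC uq.
  rewrite rho2E exprD expr2 mulrA mulfK // /rho exprD expr1 exprMn.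
  by rewrite half_sigmaK // mulrC.
by rewrite rho2E exprVn mulfV // expf_neq0.
Qed.

Lemma delta_neq0 (delta : K) : abs_trace e delta = 1 -> delta != 0.
Proof.
move=> tr1; apply: contra_eq_neq tr1 => ->.
rewrite /abs_trace big1.
  by rewrite eq_sym oner_eq0.
by move=> i _; rewrite expr0n expn_eq0.
Qed.

End Arithmetic.

(** * Coordinates of the image of a vector under xi *)

Section Coordinates.

Variables (r : nat) (r_ge2 : (2 <= r)%N).

Lemma big_coords (R : Type) (idx : R) (op : Monoid.com_law idx)
    (F : 'I_r.+1 -> R) :
  \big[op/idx]_i F i =
  op (F ord0) (op (\big[op/idx]_(i < r.+1 | (0 < i < r)%N) F i) (F ord_max)).
Proof.
rewrite (bigD1 ord0) // (bigD1 ord_max) /=; last by case: r r_ge2.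
congr (op _ _); rewrite Monoid.mulmC; congr (op _ _).
apply: eq_bigl => i; rewrite -!val_eqE /= lt0n; congr (_ && _).
by rewrite ltn_neqAle -ltnS ltn_ord andbT.
Qed.

(** Counting all the indices with big_coords gives r + 1 = 1 + (n + 1). *)
Lemma card_middle : #|[pred i : 'I_r.+1 | (0 < i < r)%N]| = (r - 1)%N.
Proof.
have := big_coords addn (fun=> 1%N).
rewrite /= sum1_card card_ord sum1_card addn1 add1n => rE.
by apply: succn_inj; rewrite subn1 prednK ?(ltnW r_ge2) //; apply: succn_inj.
Qed.

End Coordinates.

Lemma neither_end r (i : 'I_r.+1) : (0 < i < r)%N ->
  (i == ord0 = false) * (i == ord_max = false).
Proof.
by case/andP => i_gt0 i_ltr; rewrite -!val_eqE /= (gtn_eqF i_gt0) ltn_eqF.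
Qed.

Section Matrix.

Variables (e r : nat) (K : finFieldType) (eps1 eps2 delta1 delta2 : K).
Hypothesis r_ge2 : (2 <= r)%N.

Let q := (2 ^ e)%N.
Let M := xi_matrix r e eps1 eps2 delta1 delta2.
Let B := ((eps2 - eps1) / delta1) ^+ (sigma e %/ 2)%N.
Let rho := (delta1 / delta2) ^+ (sigma e %/ 2 + 1)%N.
Let norm_ratio := eps2 ^+ q.+1 / eps1 ^+ q.+1.

Let max_neq0 : (ord_max == ord0 :> 'I_r.+1) = false.
Proof. by case: r r_ge2. Qed.

Lemma mul_xi_first (X : 'rV_r.+1) : (X *m M) 0 ord0 = X 0 ord0.
Proof.
rewrite mxE (bigD1 ord0) //= big1 => [|i /negPf iN0]; rewrite mxE.
  by rewrite eqxx mulr1 addr0.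
rewrite iN0; case: ifP => _; first by rewrite (eq_sym ord0) max_neq0 mulr0.
by rewrite (eq_sym ord0) max_neq0 (eq_sym ord0) iN0 mulr0.
Qed.

Lemma mul_xi_middle (X : 'rV_r.+1) (i : 'I_r.+1) : (0 < i < r)%N ->
  (X *m M) 0 i = rho * (eps2 / eps1) * (X 0 i + B * X 0 ord0).
Proof.
move=> i_mid; have [iN0 iNmax] := neither_end i_mid.
rewrite mxE (bigD1 ord0) //= (bigD1 i) ?iN0 //= big1.
  by rewrite !mxE /= iN0 iNmax eqxx -/B -/rho; ring.
move=> k /andP[/negPf kN0 /negPf kNi].
by rewrite mxE kN0 iNmax; case: ifP => _; rewrite ?(eq_sym i) ?kNi mulr0.
Qed.

Lemma mul_xi_last (X : 'rV_r.+1) :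
  (X *m M) 0 ord_max =
  rho ^+ 2 * norm_ratio * ((r - 1)%:R * B ^+ (sigma e + 2)%N * eps2 * X 0 ord0
    + B * (\sum_(i < r.+1 | (0 < i < r)%N) X 0 i) + X 0 ord_max).
Proof.
rewrite mxE (big_coords r_ge2) /= !mxE !eqxx max_neq0 -/B -/rho -/q.
rewrite (eq_bigr (fun i => B * rho ^+ 2 * norm_ratio * X 0 i)) => [|i i_mid].
  have -> : eps2 ^+ (q + 2)%N / eps1 ^+ q.+1 = norm_ratio * eps2.
    by rewrite /norm_ratio addn2 exprSr mulrAC.
  by rewrite -mulr_sumr -[rho ^+ 2 * _ / _]mulrA -/norm_ratio; ring.
by have [iN0 iNmax] := neither_end i_mid; rewrite mxE iN0 iNmax eqxx mulrC.
Qed.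

Lemma xi_unitmx : eps1 != 0 -> eps2 != 0 -> delta1 != 0 -> delta2 != 0 ->
  M \in unitmx.
Proof.
move=> e1 e2 d1 d2.
have rhoN0 : rho != 0 by rewrite expf_neq0 // mulf_neq0 ?invr_eq0.
(* The matrix is upper triangular, hence the transpose. *)
have trigM : is_trig_mx M^T.
  apply/is_trig_mxP => i j lt_ij; rewrite !mxE -!val_eqE /=.
  rewrite (gtn_eqF (leq_ltn_trans (leq0n i) lt_ij)).
  have /ltn_eqF -> : (i < r)%N by rewrite (leq_trans lt_ij) // -ltnS.
  by rewrite (ltn_eqF lt_ij); case: ifP.
rewrite unitmxE unitfE -det_tr det_trig //; apply/prodf_neq0 => i _.
rewrite !mxE; case: (i == ord0); first exact: oner_neq0.
by case: (i == ord_max); rewrite ?eqxx !(mulf_neq0, expf_neq0, invr_neq0).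
Qed.

End Matrix.

(** * Projectivities and sets of points given by equations *)

Lemma hom_coords_projectivity r (K : finFieldType) (M : 'M[K]_r.+1)
    (uM : M \in unitmx) (P : PG r K) (X : 'rV_r.+1) :
  hom_coords (projectivity uM P) (X *m M) = hom_coords P X.
Proof.
rewrite /hom_coords /=; set f := linfun _.
have -> : X *m M = f X by rewrite lfunE.
rewrite -limg_line eq_limg_ker0 //; apply/lker0P => Y Z; rewrite !lfunE /=.
exact: (can_inj (mulmxK uM)).
Qed.

Lemma projectivity_inj r (K : finFieldType) (M : 'M[K]_r.+1)
    (uM : M \in unitmx) : injective (projectivity uM).
Proof.
move=> P Q /(congr1 (@PG_space r K)) /eqP PQ; apply/val_inj/eqP.
rewrite /= eq_limg_ker0 // in PQ; apply/lker0P => Y Z; rewrite !lfunE /=.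
exact: (can_inj (mulmxK uM)).
Qed.

(** Every vector is X *m M for some X, so the inclusion of the image and the
    surjectivity both follow from the equivalence of the equations on
    vectors: multiplication by M matches the coordinate vectors of a point
    with those of its image one by one. *)
Lemma projectivity_onto r (K : finFieldType) (M : 'M[K]_r.+1)
    (uM : M \in unitmx) (E1 E2 : 'rV[K]_r.+1 -> bool) :
  (forall X, E2 (X *m M) = E1 X) ->
  projectivity uM @: [set P | [exists X, hom_coords P X && E1 X]] =
  [set P | [exists X, hom_coords P X && E2 X]].
Proof.
move=> E12; have iff P : (projectivity uM P \in
    [set P | [exists X, hom_coords P X && E2 X]]) =
    [exists X, hom_coords P X && E1 X].
  rewrite inE; apply/existsP/existsP => -[X]; last first.
    by exists (X *m M); rewrite hom_coords_projectivity E12.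
  by rewrite -(mulmxKV uM X) hom_coords_projectivity E12; exists (X *m invmx M).
apply/setP => Q; have [g gK Kg] := injF_bij (@projectivity_inj _ _ _ uM).
rewrite -[Q]Kg iff mem_imset; last exact: projectivity_inj.
by rewrite inE.
Qed.

(** * Transport of the equations by xi *)

Section EquationsUnderXi.

Variables (e r : nat) (K : finFieldType) (eps1 eps2 delta1 delta2 : K).
Hypotheses (e_odd : odd e) (r_ge2 : (2 <= r)%N).
Hypothesis cardK : #|K| = ((2 ^ e) ^ 2)%N.

Let q := (2 ^ e)%N.

Hypotheses (eps1q : eps1 ^+ q = eps1 + 1) (eps2q : eps2 ^+ q = eps2 + 1).
Hypotheses (delta1q : delta1 ^+ q = delta1) (delta2q : delta2 ^+ q = delta2).
Hypotheses (eps1_eq : eps1 ^+ 2 + eps1 = delta1).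
Hypotheses (eps2_eq : eps2 ^+ 2 + eps2 = delta2).
Hypotheses (delta1N0 : delta1 != 0) (delta2N0 : delta2 != 0).

Let M := xi_matrix r e eps1 eps2 delta1 delta2.
Let t := (eps2 - eps1) / delta1.
Let B := t ^+ (sigma e %/ 2)%N.
Let u := delta1 / delta2.
Let rho := u ^+ (sigma e %/ 2 + 1)%N.
Let c := rho * (eps2 / eps1).
Let lam := rho ^+ 2 * (delta2 / delta1).

Let charK : 2 \in [pchar K] := pchar2 cardK.

Let cN0 : c != 0.
Proof.
have [e1N0 e2N0] := (eps_neq0 eps1_eq delta1N0, eps_neq0 eps2_eq delta2N0).
by rewrite !(mulf_neq0, expf_neq0, invr_neq0).
Qed.

(** On the hyperplane at infinity xi multiplies the coordinates
    X_1, ..., X_(r-1) by c, hence the equation by the norm of c. *)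
Lemma BT_infinity_xi (X : 'rV_r.+1) :
  BT_infinity e (X *m M) = BT_infinity e X.
Proof.
rewrite /BT_infinity mul_xi_first //.
have [X0|//] := eqVneq (X 0 ord0) 0; rewrite /=.
rewrite (eq_bigr (fun i => c ^+ q.+1 * X 0 i ^+ q.+1)) => [|i i_mid].
  by rewrite -mulr_sumr mulf_eq0 expf_eq0 (negPf cN0).
by rewrite mul_xi_middle // X0 mulr0 addr0 exprMn.
Qed.

(** Both sides of the affine equation of the target at X *m M are lam times
    the sides at X plus the same element of F_q. The entry of xi in the
    first row and last column is lam * (r - 1) * B^(sigma+2) * eps2, and eps2
    has relative trace 1: it produces the r - 1 constants B^(sigma+2) that
    Gamma_scale_shift adds, while the other entries of the last column
    produce the terms B * (x_i^q + x_i). *)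
Lemma BT_affine_xi (X : 'rV_r.+1) :
  BT_affine e eps2 (X *m M) = BT_affine e eps1 X.
Proof.
have uq : u ^+ q = u by rewrite expr_div_n delta1q delta2q.
have uN0 : u != 0 by rewrite mulf_neq0 ?invr_eq0.
have [rhoq rhos rho2] := scale_powers e_odd uN0 uq.
rewrite -/rho invf_div in rhoq rhos rho2.
have tq : t ^+ q = t.
  rewrite expr_div_n delta1q; congr (_ / _).
  rewrite -[- eps1](oppr_pchar2 charK) opprK (exprD_pow2 charK) eps1q eps2q.
  by apply: (eq_mod2 charK (t := 1)); ring.
have Bq : B ^+ q = B by rewrite exprAC tq.
have Bs : B ^+ sigma e = t by exact: half_sigmaK.
have lamq : lam ^+ q = lam.
  by rewrite exprMn exprAC rhoq expr_div_n delta1q delta2q.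
have lamN0 : lam != 0 by rewrite !(mulf_neq0, expf_neq0, invr_neq0).
rewrite /BT_affine mul_xi_first //.
have [//|X0 /=] := eqVneq (X 0 ord0) 0; rewrite -/q.
pose mid (F : 'I_r.+1 -> K) := \sum_(i < r.+1 | (0 < i < r)%N) F i.
pose y i := X 0 i / X 0 ord0; pose tr (v : K) := v ^+ q + v.
have trD v w : tr (v + w) = tr v + tr w.
  by rewrite /tr (exprD_pow2 charK) addrACA.
have trZ v w : v ^+ q = v -> tr (v * w) = v * tr w.
  by move=> vq; rewrite /tr exprMn vq mulrDr.
have tr_mid : tr (mid y) = mid (tr \o y).
  by apply: (big_morph tr trD); rewrite /tr expr0n expn_eq0 addr0.
have tr_eps2 : tr eps2 = 1.
  by rewrite /tr eps2q; apply: (eq_mod2 charK (t := eps2)); ring.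
have lastE : (X *m M) 0 ord_max / X 0 ord0 =
    lam * ((r - 1)%:R * B ^+ (sigma e + 2)%N * eps2 + B * mid y + y ord_max).
  rewrite mul_xi_last // (eps_norm eps1q eps1_eq) (eps_norm eps2q eps2_eq).
  rewrite -/t -/B -/u -/rho -/lam -[lam * _ / _]mulrA; congr (_ * _).
  by rewrite !mulrDl mulfK // -[B * _ / _]mulrA mulr_suml.
have tr_last : tr ((X *m M) 0 ord_max / X 0 ord0) =
    lam * (B ^+ (sigma e + 2)%N *+ (r - 1) + B * mid (tr \o y) +
           tr (y ord_max)).
  rewrite lastE trZ // !trD trZ; last first.
    by rewrite exprMn (natr_pow2 charK) exprAC Bq.
  by rewrite (trZ B) // tr_mid tr_eps2 mulr1 mulr_natl.
have Gamma_mid : mid (fun i => Gamma e eps2 ((X *m M) 0 i / X 0 ord0)) =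
    lam * (B ^+ (sigma e + 2)%N *+ (r - 1) + B * mid (tr \o y) +
           mid (fun i => Gamma e eps1 (y i))).
  transitivity (mid (fun i =>
      lam * (Gamma e eps1 (y i) + B ^+ (sigma e + 2)%N + B * tr (y i)))).
    apply: eq_bigr => i i_mid.
    rewrite mul_xi_middle // -/t -/B -/u -/rho -/c.
    rewrite -[c * _ / _]mulrA mulrDl mulfK // -/(y i).
    exact: (Gamma_scale_shift e_odd cardK _ eps1q eps2q eps1_eq eps2_eq).
  rewrite /mid -mulr_sumr 2!big_split /= sumr_const card_middle // -mulr_sumr.
  by congr (_ * _); rewrite -addrA addrC.
rewrite -[LHS]/(tr _ == mid _) tr_last Gamma_mid.
by rewrite (inj_eq (mulfI lamN0)) (inj_eq (addrI _)).
Qed.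

End EquationsUnderXi.

Theorem theorem3p1 (e r : nat) (K : finFieldType)
    (eps1 eps2 delta1 delta2 : K)
    (e_ge3 : (3 <= e)%N) (e_odd : odd e) (r_ge2 : (2 <= r)%N)
    (cardK : #|K| = ((2 ^ e) ^ 2)%N)
    (eps1_notin : ~~ in_Fq e eps1) (eps2_notin : ~~ in_Fq e eps2)
    (delta1_in : in_Fq e delta1) (delta2_in : in_Fq e delta2)
    (delta1_neq1 : delta1 != 1) (delta2_neq1 : delta2 != 1)
    (tr_delta1 : abs_trace e delta1 = 1) (tr_delta2 : abs_trace e delta2 = 1)
    (eps1_eq : eps1 ^+ 2 + eps1 = delta1)
    (eps2_eq : eps2 ^+ 2 + eps2 = delta2) :
  (exists xiU : xi_matrix r e eps1 eps2 delta1 delta2 \in unitmx,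
     projectivity xiU @: BT_quasi_Hermitian r e eps1
       = BT_quasi_Hermitian r e eps2)
  /\ projectively_equivalent (BT_quasi_Hermitian r e eps1)
                             (BT_quasi_Hermitian r e eps2).
Proof.
have eps1q := eps_conj cardK eps1_notin delta1_in eps1_eq.
have eps2q := eps_conj cardK eps2_notin delta2_in eps2_eq.
have d1N0 := delta_neq0 tr_delta1; have d2N0 := delta_neq0 tr_delta2.
have e1N0 := eps_neq0 eps1_eq d1N0; have e2N0 := eps_neq0 eps2_eq d2N0.
have xiU : xi_matrix r e eps1 eps2 delta1 delta2 \in unitmx by exact: xi_unitmx.
have onto : projectivity xiU @: BT_quasi_Hermitian r e eps1 =
    BT_quasi_Hermitian r e eps2.
  apply: projectivity_onto => X.
  rewrite BT_affine_xi ?BT_infinity_xi //; exact/eqP.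
by split; [exists xiU | exists (xi_matrix r e eps1 eps2 delta1 delta2), xiU].
Qed.
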